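(* Let $r \ge 1$ and $n_1, \dots, n_r \ge 1$, and let $X = S^{n_1} \times \dots \times S^{n_r}$ be endowed with a metric $d$ of the form $$d\big( (x_1, \dots, x_r), (x'_1, \dots, x'_r) \big) = f\big( d_E(x_1, x'_1), \dots, d_E(x_r, x'_r) \big),$$ where $f$ is a function such that the axioms of a metric are satisfied by $d$. If $f$ is measurable, then the following hold. (1) Let $(A,\overline A)$ be a partition of $X$ into two measurable sets. Then $|st_A - st_{\overline A}|$ depends only on the difference of the measures of $A$ and $\overline A$; that is, if $(A,\overline A)$ and $(B, \overline B)$ are two partitions of $X$ into two measurable sets with $\mu(A) - \mu(\overline A) = \mu(B) - \mu(\overline B)$, then $|st_A - st_{\overline A}| = |st_B - st_{\overline B}|$. (2) If $X$ is divided into two measurable subsets $A$ and $\overline A = X \setminus A$ of equal measure, then these two subsets have the same distribution of distance, i.e. $st_A = st_{\overline A}$. (3) If $S, S'$ are measurable subsets of $X$ such that $st_S = st_{S'}$, then their complements $\overline S = X\setminus S$ and $\overline{S'} = X \setminus S'$ satisfy $st_{\overline S} = st_{\overline{S'}}$ and $st_{S, \overline S} = st_{S', \overline{S'}}$.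
   Context: $S^{n_i} \subset \mathbb{R}^{n_i+1}$ is the sphere of unit radius with its $n_i$-dimensional surface measure, and $d_E$ denotes the Euclidean distance of $\mathbb{R}^{n_i+1}$ restricted to $S^{n_i}$ (so $f$ is a real function of $r$ variables, each ranging over $[0,2]$). $\mu$ is the product measure on $X$. $H$ is the Heaviside function, $H(x)=1$ for $x>0$ and $H(x)=0$ otherwise. For measurable sets $A, B \subset X$, the cumulative measure function of distance between points of $A$ is $St_A(\ell) = \int_A d\mu(x) \int_A d\mu(y)\, H(\ell - d(x,y))$, and the cumulative measure function of distance between a point in $A$ and a point in $B$ is $St_{A,B}(\ell) = \int_A d\mu(x) \int_B d\mu(y)\, H(\ell - d(x,y))$. The measure density functions of distance $st_A$ and $st_{A,B}$ are the derivatives with respect to $\ell$ of $St_A$ and $St_{A,B}$, e.g. $st_A(\ell) = \int_A d\mu(x)\int_A d\mu(y)\,\delta(\ell - d(x,y))$ with $\delta$ the Dirac delta. They are understood in the sense of (signed) measures/distributions on the line of distances when they are not functions, $|\cdot|$ then being the total variation measure. Equality of two measure density functions is thus equivalent to equality of the corresponding cumulative functions. These functions are not normalized: the total mass of $st_A$ is $\mu(A)^2$. *)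

(* Defs.v *)
From HB Require Import structures.
From mathcomp Require Import all_boot all_order all_algebra.
From mathcomp Require Import all_classical all_reals all_analysis.
From mathcomp Require Import measurable_realfun.

Set Implicit Arguments.
Unset Strict Implicit.
Unset Printing Implicit Defensive.

Import Order.TTheory GRing.Theory Num.Theory.
Import numFieldNormedType.Exports.

Local Open Scope classical_set_scope.
Local Open Scope ring_scope.

(* Finite product of a heterogeneous family of measurable types: dependent
   functions, with the sigma-algebra generated by the coordinate maps. *)
Definition measure_dprod_display : measure_display -> measure_display.
Proof. exact. Qed.

Definition dprod (r : nat) d (T : 'I_r -> measurableType d) : Type :=
  forall i, T i.

Section dprod_measurable.
Context (r : nat) d (T : 'I_r -> measurableType d).

Definition dprod_measurable : set (set (dprod T)) :=
  <<s \bigcup_i preimage_set_system setT (fun x : dprod T => x i) measurable >>.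

Let dprod_set0 : dprod_measurable set0.
Proof. exact: sigma_algebra0. Qed.

Let dprod_setC A : dprod_measurable A -> dprod_measurable (~` A).
Proof. exact: sigma_algebraC. Qed.

Let dprod_bigcup (F : (set (dprod T))^nat) :
  (forall i, dprod_measurable (F i)) -> dprod_measurable (\bigcup_i F i).
Proof. exact: sigma_algebra_bigcup. Qed.

HB.instance Definition _ := Pointed.copy (dprod T) (forall i, T i).
HB.instance Definition _ := @isMeasurable.Build (measure_dprod_display d)
  (dprod T) dprod_measurable dprod_set0 dprod_setC dprod_bigcup.

Lemma measurable_proj i : measurable_fun setT (fun x : dprod T => x i).
Proof.
by move=> _ B mB; apply: sub_sigma_algebra; exists i => //; exists B.
Qed.

Lemma measurable_dprodP d' (S : measurableType d') (g : S -> dprod T) :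
  (forall i, measurable_fun setT (fun s => g s i)) <-> measurable_fun setT g.
Proof.
split=> [mg|mg i]; last first.
  exact: (measurableT_comp (f := fun x : dprod T => x i) (@measurable_proj i) mg).
apply: (@measurability _ _ _ _ _ g
    (\bigcup_i preimage_set_system setT (fun x : dprod T => x i) measurable)) => //.
move=> _ [_ [i _ [B mB <-]] <-].
by rewrite setTI -comp_preimage; exact: mg.
Qed.

Lemma measurable_box (A : forall i, set (T i)) :
  (forall i, measurable (A i)) -> measurable [set x : dprod T | forall i, A i (x i)].
Proof.
move=> mA.
have -> : [set x : dprod T | forall i, A i (x i)] =
    \big[setI/setT]_(i < r) ((fun x : dprod T => x i) @^-1` A i).
  rewrite -bigcap_seq; apply/seteqP; split=> x /= Ax i; first by move=> _; exact: Ax.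
  by apply: Ax; rewrite /= mem_index_enum.
apply: bigsetI_measurable => i _; rewrite -[X in measurable X]setTI.
exact: (@measurable_proj i measurableT _ (mA i)).
Qed.

End dprod_measurable.

Section dprod_cons.
Context (r : nat) d (T : 'I_r.+1 -> measurableType d).

Definition dcons (p : T ord0 * dprod (fun i : 'I_r => T (lift ord0 i))) : dprod T :=
  fun i => match unliftP ord0 i with
           | UnliftSome j e => eq_rect_r T (p.2 j) e
           | UnliftNone e => eq_rect_r T p.1 e
           end.

Lemma dcons0 p : dcons p ord0 = p.1.
Proof.
rewrite /dcons; case: unliftP => [j e|e]; last by rewrite (eq_irrelevance e erefl).
by case/negP: (neq_lift ord0 j); apply/eqP.
Qed.

Lemma dconsS p j : dcons p (lift ord0 j) = p.2 j.
Proof.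
rewrite /dcons; case: unliftP => [k e|e].
  have jk := lift_inj e; subst k; by rewrite (eq_irrelevance e erefl).
by case/negP: (neq_lift ord0 j); apply/eqP.
Qed.

Lemma measurable_dcons : measurable_fun setT dcons.
Proof.
apply/measurable_dprodP => i; case: (unliftP ord0 i) => [j ->|->].
  rewrite (_ : dcons^~ _ = fun p => p.2 j); last first.
    by apply/funext => p; rewrite dconsS.
  exact: (measurableT_comp (f := fun x : dprod _ => x j) (measurable_proj (i := j)) measurable_snd).
rewrite (_ : dcons^~ _ = fst) //; by apply/funext => p; rewrite dcons0.
Qed.

End dprod_cons.

Section dprod_pushforward.
Local Open Scope ereal_scope.
Context (R : realType) (r : nat) d (T : 'I_r.+1 -> measurableType d).
Variables (m1 : {sigma_finite_measure set (T ord0) -> \bar R})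
  (m2 : {sigma_finite_measure set (dprod (fun i : 'I_r => T (lift ord0 i))) -> \bar R}).

Definition dprod_measureS : set (dprod T) -> \bar R :=
  pushforward (m1 \x m2) (@dcons r d T).

Let pm := measure_function_pushforward__canonical__measure_function_Measure
  (m1 \x m2) (measurable_dcons (T := T)).

Let dm0 : dprod_measureS set0 = 0.
Proof. exact: (measure0 pm). Qed.

Let dm_ge0 A : 0 <= dprod_measureS A.
Proof. exact: (measure_ge0 pm). Qed.

Let dm_sigma : semi_sigma_additive dprod_measureS.
Proof. exact: (@measure_semi_sigma_additive _ _ _ pm). Qed.

HB.instance Definition _ := isMeasure.Build _ _ _ dprod_measureS
  dm0 dm_ge0 dm_sigma.

Let dm_sigma_finite : sigma_finite setT dprod_measureS.
Proof.
have /sigma_finiteP[F [TF ndF Foo]] := sigma_finiteT m1.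
have /sigma_finiteP[G [TG ndG Goo]] := sigma_finiteT m2.
have mF k : measurable [set x : dprod T | F k (x ord0)].
  rewrite -[X in measurable X]setTI.
  exact: (@measurable_proj _ _ T ord0 measurableT _ (Foo k).1).
have mG k : measurable
    [set x : dprod T | G k (fun i : 'I_r => x (lift ord0 i))].
  rewrite -[X in measurable X]setTI.
  have mt : measurable_fun setT
      ((fun x i => x (lift ord0 i)) : dprod T -> dprod (fun i : 'I_r => T (lift ord0 i))).
    by apply/measurable_dprodP => i; exact: measurable_proj.
  exact: (mt measurableT _ (Goo k).1).
exists (fun k => [set x : dprod T | F k (x ord0)] `&`
                 [set x | G k (fun i : 'I_r => x (lift ord0 i))]) => [|k].
  apply/esym; rewrite -subTset => x _.
  have [n _ Fn] : (\bigcup_k F k) (x ord0) by rewrite -TF.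
  have [m _ Gm] : (\bigcup_k G k) (fun i : 'I_r => x (lift ord0 i)) by rewrite -TG.
  exists (maxn n m) => //; split => /=.
    by move: Fn; exact/subsetPset/ndF/leq_maxl.
  by move: Gm; exact/subsetPset/ndG/leq_maxr.
split; first exact: measurableI.
rewrite /dprod_measureS /pushforward.
rewrite (_ : _ @^-1` _ = F k `*` G k); last first.
  apply/seteqP; split => -[a b] /=; rewrite dcons0/=.
    move=> [Fa Gb]; split => //; congr (G k _) : Gb.
    by apply: functional_extensionality_dep => i; rewrite dconsS.
  move=> [Fa Gb]; split => //; congr (G k _) : Gb.
  by apply: functional_extensionality_dep => i; rewrite dconsS.
have [? ?] := Foo k; have [? ?] := Goo k.
by rewrite product_measure1E// lte_mul_pinfty// ge0_fin_numE.
Qed.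

HB.instance Definition _ := Measure_isSigmaFinite.Build _ _ _ dprod_measureS
  dm_sigma_finite.

End dprod_pushforward.

(* The product measure, built by transporting the binary product measure along
   dcons; dprod_measure_box is its defining property on boxes. *)
Fixpoint dprod_measure (R : realType) (r : nat) d :
    forall T : 'I_r -> measurableType d,
    (forall i, {sigma_finite_measure set (T i) -> \bar R}) ->
    {sigma_finite_measure set (dprod T) -> \bar R} :=
  match r with
  | 0 => fun T _ => \d_(point : dprod T)
  | r'.+1 => fun T m =>
      dprod_measureS (m ord0) (dprod_measure (fun i => m (lift ord0 i)))
  end.

Section dprod_measure_theory.
Local Open Scope ereal_scope.
Context (R : realType).

Lemma dprod_measure_box (r : nat) d (T : 'I_r -> measurableType d)
    (m : forall i, {sigma_finite_measure set (T i) -> \bar R})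
    (A : forall i, set (T i)) : (forall i, measurable (A i)) ->
  dprod_measure m [set x | forall i, A i (x i)] = \prod_(i < r) m i (A i).
Proof.
elim: r T m A => [|r IH] T m A mA.
  rewrite big_ord0 /= diracE mem_set//=; by case.
rewrite big_ord_recl -(IH (fun i : 'I_r => T (lift ord0 i)) (fun i => m (lift ord0 i))) //.
rewrite /= /dprod_measureS /pushforward.
have mB : measurable [set x : dprod (fun i : 'I_r => T (lift ord0 i)) |
    forall i, A (lift ord0 i) (x i)].
  exact: (@measurable_box _ _ _ (fun i => A (lift ord0 i))).
rewrite -product_measure1E//.
congr (_ _); apply/seteqP; split => -[a b] /=.
  by move=> Aab; split => [|i]; [have := Aab ord0|have := Aab (lift ord0 i)];
    rewrite ?dcons0 ?dconsS.
by move=> [Aa Ab] i; case: (unliftP ord0 i) => [j|] ->; rewrite ?dcons0 ?dconsS.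
Qed.

Lemma dprod_measure_fin (r : nat) d (T : 'I_r -> measurableType d)
    (m : forall i, {sigma_finite_measure set (T i) -> \bar R}) :
  (forall i, m i setT < +oo) -> fin_num_fun (dprod_measure m).
Proof.
move=> moo; apply: lty_fin_num_fun => /=.
have mE : dprod_measure m setT = \prod_(i < r) m i setT.
  rewrite -dprod_measure_box; last by move=> i; exact: measurableT.
  by congr (dprod_measure m _); apply/seteqP; split.
suff : dprod_measure m setT < +oo by [].
rewrite mE ltey_eq; apply/orP; left.
apply: (big_ind (fun x => x \is a fin_num)) => //.
  by move=> x y xfin yfin; exact: fin_numM.
by move=> i _; rewrite ge0_fin_numE.
Qed.

End dprod_measure_theory.

Notation euclid R m := (dprod (fun _ : 'I_m => measurableTypeR R)).

Section euclid.
Context {R : realType}.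

Definition lebesgue_measure_n (m : nat) : {sigma_finite_measure set (euclid R m) -> \bar R} :=
  dprod_measure (fun _ => @lebesgue_measure R).

Definition d_E m (x y : euclid R m) : R := Num.sqrt (\sum_(i < m) (x i - y i) ^+ 2).

Definition enorm m (x : euclid R m) : R := Num.sqrt (\sum_(i < m) (x i) ^+ 2).

Lemma measurable_enorm m : measurable_fun setT (@enorm m).
Proof.
have msqrt : measurable_fun [set: R] (@Num.sqrt R).
  by apply: continuous_measurable_fun; exact: sqrt_continuous.
apply: (measurableT_comp msqrt).
apply: measurable_sum => i; apply: measurable_funX.
exact: (@measurable_proj _ _ (fun _ : 'I_m => measurableTypeR R) i).
Qed.

End euclid.

Section sphere.
Context (R : realType) (n : nat).

Definition unit_sphere : set (euclid R n.+1) := [set x | enorm x = 1].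

Definition sphere : Type := set_type unit_sphere.

HB.instance Definition _ := SubType.copy sphere (set_type unit_sphere).
HB.instance Definition _ := Choice.copy sphere (set_type unit_sphere).

Let pole : euclid R n.+1 := fun i => (i == ord0)%:R.

Let enorm_pole : pole \in unit_sphere.
Proof.
rewrite inE /unit_sphere/= /enorm big_ord_recl /pole eqxx big1 ?addr0 ?expr1n ?sqrtr1// => i _.
by rewrite expr0n.
Qed.

HB.instance Definition _ := isPointed.Build sphere (Sub pole enorm_pole).

Definition sphere_measurable : set (set sphere) :=
  preimage_set_system setT (val : sphere -> euclid R n.+1) measurable.

Let sphere_sigma : sigma_algebra setT sphere_measurable.
Proof. by apply: sigma_algebra_preimage; exact: sigma_algebra_measurable. Qed.

Let sphere_set0 : sphere_measurable set0.
Proof. by case: sphere_sigma. Qed.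

Let sphere_setC A : sphere_measurable A -> sphere_measurable (~` A).
Proof. by case: sphere_sigma => _ + _ => /[apply]; rewrite setTD. Qed.

Let sphere_bigcup (F : (set sphere)^nat) :
  (forall i, sphere_measurable (F i)) -> sphere_measurable (\bigcup_i F i).
Proof. by case: sphere_sigma => _ _; exact. Qed.

HB.instance Definition _ := @isMeasurable.Build default_measure_display
  sphere sphere_measurable sphere_set0 sphere_setC sphere_bigcup.

End sphere.

Section surface_measure.
Local Open Scope ereal_scope.
Context (R : realType) (n : nat).

Definition cone (A : set (sphere R n)) : set (euclid R n.+1) :=
  [set (fun i => (t * val x i)%R) | t in `]0%R, 1%R]%classic & x in A].

(* Lebesgue measure in polar coordinates is t ^ n dt x d(sigma), so the cone over A
   with radii in ]0, 1] has volume sigma(A) / (n + 1). *)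
Definition surface_measure (A : set (sphere R n)) : \bar R :=
  n.+1%:R%:E * @lebesgue_measure_n R n.+1 (cone A).

Let dir (y : euclid R n.+1) : sphere R n :=
  insubd (point : sphere R n) ((fun i => y i / enorm y)%R : euclid R n.+1).

Let pball : set (euclid R n.+1) := [set y | (0 < enorm y <= 1)%R].

Let enormZ (t : R) (y : euclid R n.+1) :
  enorm ((fun i => t * y i)%R : euclid R n.+1) = (`|t| * enorm y)%R.
Proof.
rewrite /enorm; under eq_bigr do rewrite exprMn.
by rewrite -mulr_sumr sqrtrM ?sqr_ge0// sqrtr_sqr.
Qed.

Let val_dir y : (0 < enorm y)%R -> val (dir y) = (fun i => y i / enorm y)%R.
Proof.
move=> y0; rewrite val_insubd ifT// inE/unit_sphere/=.
rewrite (_ : (fun i => _) = (fun i => (enorm y)^-1 * y i)%R); last first.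
  by apply/funext => i; rewrite mulrC.
by rewrite enormZ normfV gtr0_norm// mulVf// gt_eqF.
Qed.

Let coneE A : cone A = dir @^-1` A `&` pball.
Proof.
apply/seteqP; split => [y [t] /=|y [Ay]]; rewrite ?in_itv/=.
  move=> /andP[t0 t1] [x Ax <-].
  have ny : enorm ((fun i => t * val x i)%R : euclid R n.+1) = t.
    have := valP x; rewrite inE/unit_sphere/= => x1.
    by rewrite enormZ x1 mulr1 gtr0_norm.
  rewrite /pball/= ny t0 t1; split => //.
  suff -> : dir ((fun i => t * val x i)%R) = x by [].
  apply: val_inj; rewrite val_dir ny//; apply/funext => i.
  by rewrite mulrAC divff ?mul1r// gt_eqF.
rewrite /pball/= => /andP[y0 y1].
exists (enorm y); first by rewrite /= in_itv/= y0.
exists (dir y) => //; apply/funext => i.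
by rewrite val_dir// mulrC divfK// gt_eqF.
Qed.

Let measurable_pball : measurable pball.
Proof.
rewrite (_ : pball = @enorm R n.+1 @^-1` `]0%R, 1%R]); last first.
  by apply/seteqP; split => y; rewrite /pball/= in_itv.
by rewrite -[X in measurable X]setTI; exact: measurable_enorm.
Qed.

Let measurable_dir : measurable_fun setT dir.
Proof.
move=> _ _ [B mB <-]; rewrite !setTI.
have mq : measurable_fun setT
    (fun y : euclid R n.+1 => (fun i => y i / enorm y)%R : euclid R n.+1).
  apply/measurable_dprodP => i.
  apply: (measurable_funM (f := fun y : euclid R n.+1 => y i)
    (g := fun y => ((enorm y)^-1)%R)).
    exact: (@measurable_proj _ _ (fun _ : 'I_n.+1 => measurableTypeR R) i).
  rewrite (_ : (fun y => _) = (fun t => t `^ (-1))%R \o @enorm R n.+1).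
    by apply: measurableT_comp; [exact: measurable_powR|exact: measurable_enorm].
  by apply/funext => y /=; rewrite powR_inv1 ?sqrtr_ge0.
have m0 : measurable [set y : euclid R n.+1 | enorm y = 0%R].
  rewrite -[X in measurable X]setTI.
  by apply: (@measurable_enorm R n.+1 measurableT [set 0%R]); exact: measurable_set1.
pose q (y : euclid R n.+1) : euclid R n.+1 := (fun i => y i / enorm y)%R.
rewrite (_ : _ @^-1` _ = (q @^-1` B `\` [set y | enorm y = 0%R]) `|`
    [set y | enorm y = 0%R /\ B (val (point : sphere R n))]); last first.
  have dir0 y : enorm y = 0%R -> dir y = point.
    move=> y0; rewrite /dir y0 /insubd insubN// notin_setE/unit_sphere/=.
    rewrite (_ : (fun i => _) = (fun i => 0 * y i)%R); last first.
      by apply/funext => i; rewrite invr0 mulr0 mul0r.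
    by rewrite enormZ normr0 mul0r => /eqP; rewrite eq_sym oner_eq0.
  have dirn y : enorm y <> 0%R -> val (dir y) = q y.
    by move=> /eqP y0; rewrite val_dir// lt0r y0 sqrtr_ge0.
  apply/seteqP; split => y /=.
    by have [y0|/eqP y0] := eqVneq (enorm y) 0%R; [rewrite dir0//; right|
      rewrite dirn//; left].
  by move=> [[By y0]|[y0 Bp]]; [rewrite dirn|rewrite dir0].
apply: measurableU.
  by apply: measurableD => //; rewrite -[X in measurable X]setTI; exact: mq.
have [Bp|Bp] := pselect (B (val (point : sphere R n))).
  by rewrite (_ : [set _ | _] = [set y | enorm y = 0%R])//; apply/seteqP; split => y //= [].
by rewrite (_ : [set _ | _] = set0)//; apply/seteqP; split => y //= [].
Qed.

Let sm : {measure set (sphere R n) -> \bar R} := mscale (NngNum (ler0n R n.+1))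
  (measure_function_pushforward__canonical__measure_function_Measure
    (mrestr (@lebesgue_measure_n R n.+1) measurable_pball) measurable_dir).

Let smE : surface_measure = sm.
Proof. by apply/funext => A; rewrite /surface_measure coneE. Qed.

Let sm0 : surface_measure set0 = 0.
Proof. by rewrite smE measure0. Qed.

Let sm_ge0 A : 0 <= surface_measure A.
Proof. by rewrite smE. Qed.

Let sm_sigma : semi_sigma_additive surface_measure.
Proof. by rewrite smE; exact: measure_semi_sigma_additive. Qed.

HB.instance Definition _ := isMeasure.Build _ _ _ surface_measure
  sm0 sm_ge0 sm_sigma.

Let sm_fin : fin_num_fun surface_measure.
Proof.
apply: lty_fin_num_fun; rewrite /= /surface_measure (coneE setT) preimage_setT setTI.
rewrite lte_mul_pinfty//.
set box := [set y : euclid R n.+1 | forall i, `[(-1)%R, 1%R]%classic (y i)].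
have mbox : measurable box.
  apply: (@measurable_box _ _ (fun _ : 'I_n.+1 => measurableTypeR R)
    (fun=> `[(-1)%R, 1%R]%classic)) => i.
  exact: measurable_itv.
have ballbox : pball `<=` box.
  move=> y /andP[y0 y1] i /=; rewrite in_itv/= -ler_norml.
  apply: le_trans y1; rewrite -sqrtr_sqr ler_sqrt.
    by rewrite (bigD1 i)//= lerDl sumr_ge0// => j _; exact: sqr_ge0.
  by rewrite sumr_ge0// => j _; exact: sqr_ge0.
have /le_lt_trans : lebesgue_measure_n n.+1 pball <= lebesgue_measure_n n.+1 box.
  by apply: le_measure; rewrite ?inE.
apply; rewrite /lebesgue_measure_n /box.
rewrite (@dprod_measure_box R _ _ (fun _ : 'I_n.+1 => measurableTypeR R) _
  (fun=> `[(-1)%R, 1%R]%classic)); last first.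
  by move=> i; exact: measurable_itv.
rewrite ltey_eq; apply/orP; left.
apply: (big_ind (fun x => x \is a fin_num)) => //.
  by move=> x y xfin yfin; exact: fin_numM.
by move=> i _; rewrite /= lebesgue_measure_itv/=; case: ifPn.
Qed.

HB.instance Definition _ := Measure_isFinite.Build _ _ _ surface_measure sm_fin.

End surface_measure.

Definition is_metric (R : realType) (X : Type) (dist : X -> X -> R) : Prop :=
  [/\ forall x y, 0 <= dist x y,
      forall x y, dist x y = 0 <-> x = y,
      forall x y, dist x y = dist y x
    & forall x y z, dist x z <= dist x y + dist y z].

Definition heaviside (R : realType) (x : R) : R := if 0 < x then 1 else 0.

Section measure_functions_of_distance.
Local Open Scope ereal_scope.
Context (R : realType) d (X : measurableType d).
Variables (mu : {measure set X -> \bar R}) (dist : X -> X -> R).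

Definition cumulative_distance (A B : set X) (l : R) : \bar R :=
  \int[mu]_(x in A) \int[mu]_(y in B) (heaviside (l - dist x y))%:E.

(* st_{A,B} as a measure E |-> st_{A,B}(E) on the line of distances, where
   "delta (l - dist x y) dl" is the Dirac measure at dist x y; st_A is st_{A,A}.
   It is the derivative of the cumulative function in the sense that its mass
   on ]-oo, l[ is the value of that function at l. *)
Definition density_distance (A B : set X) (E : set R) : \bar R :=
  \int[mu]_(x in A) \int[mu]_(y in B) \d_(dist x y) E.

Lemma density_distance_cumulative A B l :
  density_distance A B `]-oo, l[%classic = cumulative_distance A B l.
Proof.
apply: eq_integral => x _; apply: eq_integral => y _.
rewrite diracE /heaviside subr_gt0; congr (_%:E).
by rewrite mem_setE in_itv/=; case: ifPn.
Qed.

End measure_functions_of_distance.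

Section variation_measure.
Local Open Scope ereal_scope.
Context d (T : measurableType d) (R : realType).

(* Total variation measure, by countable measurable partitions; it is defined for
   a bare set function (meaningful when nu is a charge) because whether
   density_distance is a measure depends on hypotheses on dist. It agrees with
   charge_variation, see variation_measure_charge. *)
Definition variation_measure (nu : set T -> \bar R) (E : set T) : \bar R :=
  ereal_sup [set \sum_(0 <= k <oo) `|nu (F k)| | F in
    [set F : (set T)^nat |
      [/\ forall k, measurable (F k), trivIset setT F & \bigcup_k F k = E]]].

Lemma variation_measure_charge (nu : {charge set T -> \bar R}) (P N : set T)
    (nuPN : hahn_decomposition nu P N) (E : set T) : measurable E ->
  variation_measure nu E = charge_variation nuPN E.
Proof.
move=> mE; apply/eqP; rewrite eq_le; apply/andP; split.
  apply: ge_ereal_sup => _ [F [mF tF FE] <-].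
  have -> : charge_variation nuPN E = \sum_(0 <= k <oo) charge_variation nuPN (F k).
    rewrite -FE; apply/esym/cvg_lim => //.
    by apply: measure_semi_sigma_additive => //; rewrite FE.
  by apply: lee_nneseries => // k _; exact: abse_charge_variation.
have [[mP posP] [mN negN] PNT PN0] := nuPN.
apply: ereal_sup_ubound; exists (bigcup2 (E `&` P) (E `&` N)).
  split.
  - by move=> [|[|k]] //=; rewrite /bigcup2/=; exact: measurableI.
  - apply/trivIsetP => -[|[|i]] [|[|j]] //= _ _ _; rewrite /bigcup2/= ?set0I ?setI0//.
      by rewrite setIACA PN0 setI0.
    by rewrite setIACA [N `&` P]setIC PN0 setI0.
  - by rewrite bigcup2E -setIUr PNT setIT.
rewrite (nneseries_split 0 2)//= big_mkord.
rewrite eseries0 ?adde0; last by move=> [|[|k]]//= _ _; rewrite charge0 abse0.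
rewrite !big_ord_recl big_ord0/= adde0 /charge_variation/=.
rewrite jordan_posE cjordan_posE jordan_negE cjordan_negE /crestr0 mem_set//=.
rewrite gee0_abs ?lee0_abs//.
  by apply: negN; [exact: measurableI|exact: subIsetr].
by apply: posP; [exact: measurableI|exact: subIsetr].
Qed.

End variation_measure.

Notation prod_spheres R n := (dprod (fun i => sphere R (n i))).

Section prod_spheres.
Context (R : realType) (r : nat) (n : 'I_r -> nat).

Definition prod_surface_measure :
    {sigma_finite_measure set (prod_spheres R n) -> \bar R} :=
  dprod_measure (fun i => @surface_measure R (n i)).

Lemma prod_surface_measure_fin : fin_num_fun prod_surface_measure.
Proof.
apply: dprod_measure_fin => i.
exact/fin_num_fun_lty/(fin_num_measure (@surface_measure R (n i))).
Qed.

(* Only the values of f on [0, 2] ^ r matter, since d_E <= 2 on a unit sphere. *)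
Definition dist_of (f : euclid R r -> R) (x y : prod_spheres R n) : R :=
  f (fun i => d_E (val (x i)) (val (y i))).

End prod_spheres.

(* Main.v *)
Require Import Defs.
From HB Require Import structures.
From mathcomp Require Import all_boot all_order all_algebra.
From mathcomp Require Import all_classical all_reals all_analysis.
From mathcomp Require Import measurable_realfun.
From mathcomp Require Import ring lra.

Import Order.TTheory GRing.Theory Num.Theory.
Import numFieldNormedType.Exports.

Local Open Scope classical_set_scope.
Local Open Scope ring_scope.

Set Implicit Arguments.
Unset Strict Implicit.
Unset Printing Implicit Defensive.

(** Fix a measurable set [E] of distances and let [g x] be the measure of the set
    of points whose distance to [x] lies in [E].  The whole theorem rests on the
    fact that [g] is a constant [c] (lemma [measure_at_distance_cst]).  Splitting
    the second point between [A] and its complement [A'] gives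
      [st_{A,A} E + st_{A,A'} E = c * mu A]  and
      [st_{A',A'} E + st_{A',A} E = c * mu A'],
    and [st_{A,A'} = st_{A',A}] by Tonelli and the symmetry of the distance.
    Subtracting, [st_A E - st_{A'} E = c * (mu A - mu A')], which yields (1) and
    (2).  For (3), the total mass of [st_A] is [mu A ^ 2], so [st_A] determines
    [mu A], and the identities above then determine [st_{A,A'}] and [st_{A'}].

    Why [g] is constant: any point of a sphere is sent to any other one by a
    hyperplane reflection, the product of such reflections is an isometry of [X]
    for every distance of the given form, and it preserves [mu].  The last point
    reduces, factor by factor ([preserves_dprod]) and from the surface measure to
    the volume of cones ([preserves_sphere_reflection]), to the invariance of the
    Lebesgue measure of a Euclidean space under linear isometries.

    That invariance ([preserves_lebesgue_n_isometry]) is obtained without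
    determinants.  The image measure of [lambda] under a surjective additive
    isometry [T] is again translation invariant, so the classical uniqueness
    argument for Haar measures applies: with [B] the unit ball, evaluating by
    Tonelli in both orders the measure of the pairs [(x, y)] such that [x] is in
    [B] and [T y + x] is in [A] gives
      [lambda (T^-1 A) * lambda B = lambda B * lambda A],
    where the ball appears on both sides because [T] preserves it. *)

(** * Densities of distance when all points see the same distances *)

Lemma adde_fin_inj (R : realType) (x : \bar R) : x \is a fin_num ->
  injective (fun y => x + y)%E.
Proof.
move=> xfin; apply: (can_inj (g := fun y => y - x)%E) => y /=.
by rewrite (addeC x) addeK.
Qed.

Section constant_sections.
Local Open Scope ereal_scope.

Lemma exchange_sections (R : realType) d1 d2 (T1 : measurableType d1)
    (T2 : measurableType d2) (m1 : {sigma_finite_measure set T1 -> \bar R})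
    (m2 : {sigma_finite_measure set T2 -> \bar R}) (W : set (T1 * T2)) :
  measurable W ->
  \int[m1]_x m2 (xsection W x) = \int[m2]_y m1 (ysection W y).
Proof.
move=> mW; have := indic_fubini_tonelli m1 m2 mW.
by rewrite indic_fubini_tonelli_FE// indic_fubini_tonelli_GE.
Qed.

Context (R : realType) d (X : measurableType d)
  (mu : {sigma_finite_measure set X -> \bar R}) (dist : X -> X -> R).

Definition pairs_at_distance (E : set R) : set (X * X) := [set p | E (dist p.1 p.2)].

Lemma density_distance_xsection (A B : set X) (E : set R) :
  measurable B -> measurable (pairs_at_distance E) ->
  density_distance mu dist A B E =
  \int[mu]_(x in A) mu (xsection (pairs_at_distance E) x `&` B).
Proof.
move=> mB mE; apply: eq_integral => x _.
rewrite -integral_indic//; last exact: measurable_xsection.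
apply: eq_integral => y _; rewrite diracE indicE mem_xsection.
by congr ((nat_of_bool _)%:R%:E); apply/idP/idP; rewrite !inE.
Qed.

Lemma density_distance_rectangle (A B : set X) (E : set R) :
  measurable A -> measurable B -> measurable (pairs_at_distance E) ->
  density_distance mu dist A B E =
  \int[mu]_x mu (xsection (pairs_at_distance E `&` A `*` B) x).
Proof.
move=> mA mB mE; rewrite density_distance_xsection// integral_mkcond.
apply: eq_integral => x _; rewrite patchE; case: ifPn => [|] xA.
  congr (mu _); apply/seteqP; split => y; rewrite /xsection/= !inE/=.
    by move=> [? ?]; split => //; split => //; exact: set_mem.
  by move=> [? []].
rewrite (_ : xsection _ x = set0) ?measure0//.
apply/seteqP; split => y //; rewrite /xsection/= inE/= => -[_ [Ax _]].
by move: xA; rewrite notin_setE; apply.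
Qed.

(** The indicator of the pairs at distance in [E] is a symmetric kernel, and
    Tonelli exchanges the roles of the two points. *)
Lemma density_distance_sym (A B : set X) (E : set R) :
  (forall x y, dist x y = dist y x) ->
  measurable A -> measurable B -> measurable (pairs_at_distance E) ->
  density_distance mu dist A B E = density_distance mu dist B A E.
Proof.
move=> dC mA mB mE; rewrite !density_distance_rectangle// exchange_sections.
  apply: eq_integral => x _; congr (mu _).
  apply/seteqP; split => y; rewrite /xsection /ysection/= !inE /pairs_at_distance/=.
    by move=> [? []]; rewrite dC.
  by move=> [? []]; rewrite dC.
by apply: measurableI => //; exact: measurableX.
Qed.

(** Every point of [A] contributes the same amount [c], whatever the way in which
    the second point is distributed between [B] and its complement. *)
Lemma density_distance_complement (c : \bar R) (A B : set X) (E : set R) :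
  measurable A -> measurable B -> measurable (pairs_at_distance E) ->
  (forall x, mu (xsection (pairs_at_distance E) x) = c) ->
  density_distance mu dist A B E + density_distance mu dist A (~` B) E =
  c * mu A.
Proof.
move=> mA mB mE gc.
have mBC : measurable (~` B) by exact: measurableC.
rewrite !density_distance_xsection//.
have mf C : measurable C ->
    measurable_fun A (fun x => mu (xsection (pairs_at_distance E) x `&` C)).
  move=> mC; apply: measurable_funTS.
  rewrite (_ : (fun x => _) = mu \o xsection (pairs_at_distance E `&` setT `*` C)).
    apply: measurable_fun_xsection.
    by apply: measurableI => //; exact: measurableX.
  apply/funext => x /=; congr (mu _).
  by apply/seteqP; split => y; rewrite /xsection/= !inE/= => -[? //]; case.
rewrite -ge0_integralD//; [|exact: mf..].
rewrite -integral_cst//; apply: eq_integral => x _ /=.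
have mx : measurable (xsection (pairs_at_distance E) x) by exact: measurable_xsection.
rewrite -(gc x) -measureU//; [|exact: measurableI|exact: measurableI|].
- by rewrite -setIUr setUv setIT.
- by rewrite setIACA setICr setI0.
Qed.

Hypothesis mufin : fin_num_fun mu.

Lemma cst_section_fin (c : \bar R) (E : set R) : measurable (pairs_at_distance E) ->
  (forall x, mu (xsection (pairs_at_distance E) x) = c) -> c \is a fin_num.
Proof.
by move=> mE gc; rewrite -(gc point) mufin//; exact: measurable_xsection.
Qed.

Lemma density_distance_fin (c : \bar R) (A B : set X) (E : set R) :
  measurable A -> measurable B -> measurable (pairs_at_distance E) ->
  (forall x, mu (xsection (pairs_at_distance E) x) = c) ->
  density_distance mu dist A B E \is a fin_num.
Proof.
move=> mA mB mE gc.
have : density_distance mu dist A B E + density_distance mu dist A (~` B) E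
    \is a fin_num.
  rewrite (@density_distance_complement c)//.
  by rewrite fin_numM ?mufin// (cst_section_fin mE gc).
by rewrite fin_numD => /andP[].
Qed.

(** The cross terms between [A] and its complement are equal and finite, so they
    cancel. *)
Lemma density_distanceB (c : \bar R) (A : set X) (E : set R) :
  (forall x y, dist x y = dist y x) ->
  measurable A -> measurable (pairs_at_distance E) ->
  (forall x, mu (xsection (pairs_at_distance E) x) = c) ->
  density_distance mu dist A A E - density_distance mu dist (~` A) (~` A) E =
  c * (mu A - mu (~` A)).
Proof.
move=> dC mA mE gc; have mAC : measurable (~` A) by exact: measurableC.
have cfin := cst_section_fin mE gc.
rewrite muleBr//; last by rewrite fin_num_adde_defl// fin_numN mufin.
rewrite -(density_distance_complement mA mA mE gc).
rewrite -(density_distance_complement mAC mA mE gc).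
rewrite (density_distance_sym dC mAC mA mE).
have := density_distance_fin mA mA mE gc.
have := density_distance_fin mA mAC mE gc.
have := density_distance_fin mAC mAC mE gc.
move=> /fineK <- /fineK <- /fineK <-.
by rewrite -!EFinD; congr EFin; ring.
Qed.

End constant_sections.

(** Only measurable pieces enter the supremum that defines the total variation. *)
Lemma eq_variation_measure d (T : measurableType d) (R : realType)
    (nu nu' : set T -> \bar R) (E : set T) :
  (forall F, measurable F -> nu F = nu' F) ->
  variation_measure nu E = variation_measure nu' E.
Proof.
move=> nunu'; rewrite /variation_measure; congr ereal_sup.
apply/seteqP; split => _ [F [mF tF FE] <-]; exists F => //;
  by apply: eq_eseriesr => k _; rewrite nunu'.
Qed.

(** * Measure-preserving maps *)

Section preserving.
Local Open Scope ereal_scope.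

Definition preserves (R : realType) d (T : measurableType d)
    (m : set T -> \bar R) (g : T -> T) :=
  measurable_fun setT g /\ forall A, measurable A -> m (g @^-1` A) = m A.

(** The section at [x] of the preimage of [A] is the preimage under [g2] of the
    section of [A] at [g1 x], so Tonelli reduces the claim to the integral along
    [g1] of the measure of the sections. *)
Lemma preserves_prod (R : realType) d1 d2 (T1 : measurableType d1)
    (T2 : measurableType d2) (m1 : {sigma_finite_measure set T1 -> \bar R})
    (m2 : {sigma_finite_measure set T2 -> \bar R}) g1 g2 :
  preserves m1 g1 -> preserves m2 g2 ->
  preserves (m1 \x m2) (fun p => (g1 p.1, g2 p.2)).
Proof.
move=> [mg1 g1P] [mg2 g2P].
have mg : measurable_fun setT (fun p : T1 * T2 => (g1 p.1, g2 p.2)).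
  apply: measurable_fun_pair.
    exact: measurableT_comp mg1 measurable_fst.
  exact: measurableT_comp mg2 measurable_snd.
split => // A mA; rewrite /product_measure1.
transitivity (\int[m1]_x ((m2 \o xsection A) \o g1) x).
  apply: eq_integral => x _ /=.
  rewrite -[RHS]g2P; last exact: measurable_xsection.
  by congr (m2 _).
have /= <- := @ge0_integral_pushforward _ _ _ _ _ _ mg1 m1 setT
  (m2 \o xsection A) measurableT.
- by apply: eq_measure_integral => B mB _; rewrite /= /pushforward g1P.
- exact: measurable_fun_xsection.
- by move=> x _; exact: measure_ge0.
Qed.

(** Used both for translations of a Euclidean space, whose factors are lines, and
    for products of reflections of spheres. *)
Lemma preserves_dprod (R : realType) (r : nat) d (T : 'I_r -> measurableType d)
    (m : forall i, {sigma_finite_measure set (T i) -> \bar R})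
    (g : forall i, T i -> T i) :
  (forall i, preserves (m i) (@g i)) ->
  preserves (dprod_measure m) (fun x : dprod T => (fun i => g i (x i)) : dprod T).
Proof.
move=> gP; have mg : measurable_fun setT
    (fun x : dprod T => (fun i => g i (x i)) : dprod T).
  apply/measurable_dprodP => i; apply: (measurableT_comp (f := g i)).
    by have [] := gP i.
  exact: measurable_proj.
split => //; elim: r T m g gP mg => [|r IH] T m g gP mg A mA.
  have E (x : dprod T) : (fun i => g i (x i)) = x :> dprod T.
    by apply: functional_extensionality_dep => i; have := ltn_ord i; rewrite ltn0.
  by rewrite (_ : _ @^-1` A = A)//; apply/seteqP; split => x /=; rewrite E.
have g'P i : preserves (m (lift ord0 i)) (@g (lift ord0 i)) by exact: gP.
have mg' : measurable_fun setT
    (fun x : dprod (fun i => T (lift ord0 i)) =>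
      (fun i => g _ (x i)) : dprod (fun i => T (lift ord0 i))).
  apply/measurable_dprodP => i; apply: (measurableT_comp (f := g (lift ord0 i))).
    by have [] := g'P i.
  exact: (measurable_proj (T := fun i => T (lift ord0 i))).
have [_ /(_ (@dcons r d T @^-1` A))] := preserves_prod (gP ord0)
  (conj mg' (IH _ (fun i => m (lift ord0 i)) _ g'P mg')).
rewrite /= /dprod_measureS /pushforward => <-.
  congr (_ _); apply/seteqP; split => -[a b]/=;
  rewrite (_ : (fun i => _) = dcons (g ord0 a, (fun i => g _ (b i))
      : dprod (fun i => T (lift ord0 i))))//;
  apply: functional_extensionality_dep => i;
  by case: (unliftP ord0 i) => [j|] ->; rewrite ?dcons0 ?dconsS.
by rewrite -[X in measurable X]setTI; exact: measurable_dcons.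
Qed.

Lemma preserves_lebesgue_translation (R : realType) (a : R) :
  preserves (@lebesgue_measure R) (fun x : R => (x + a)%R).
Proof.
have ma : measurable_fun [set: measurableTypeR R]
    (fun x => (x + a)%R : measurableTypeR R).
  by apply: measurable_funD => //; exact: measurable_cst.
split=> // A mA; apply/esym.
pose pm := measure_function_pushforward__canonical__measure_function_Measure
  (@lebesgue_measure R) ma.
apply: (@lebesgue_measure_unique R pm) => // _ [[b c] _ <-].
rewrite /= /pushforward.
have -> : (fun x : R => (x + a)%R) @^-1` `]b, c] = `](b - a)%R, (c - a)%R]%classic.
  by apply/seteqP; split => x /=; rewrite !in_itv/= ltrBlDr lerBrDr.
rewrite !lebesgue_measure_itv/= !lte_fin ltrD2r.
by case: ifPn => // _; rewrite -!EFinB; congr EFin; ring.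
Qed.

End preserving.

(** * Hyperplane reflections *)

Section euclid_isometries.
Context (R : realType) (m : nat).
Implicit Types x y u : euclid R m.

Definition eadd x y : euclid R m := fun i => x i + y i.
Definition escale (t : R) x : euclid R m := fun i => t * x i.
Definition dot x y : R := \sum_(i < m) x i * y i.

Lemma enormE x : enorm x = Num.sqrt (dot x x).
Proof.
by rewrite /enorm /dot; congr Num.sqrt; apply: eq_bigr => i _; rewrite expr2.
Qed.

Lemma dotC x y : dot x y = dot y x.
Proof. by apply: eq_bigr => i _; rewrite mulrC. Qed.

Lemma dotDl x y z : dot (eadd x y) z = dot x z + dot y z.
Proof. by rewrite /dot -big_split; apply: eq_bigr => i _; rewrite /= mulrDl. Qed.

Lemma dotZl t x y : dot (escale t x) y = t * dot x y.
Proof. by rewrite /dot mulr_sumr; apply: eq_bigr => i _; rewrite mulrA. Qed.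

Lemma measurable_dot u : measurable_fun setT (dot u).
Proof.
apply: measurable_sum => i; apply: measurable_funM; first exact: measurable_cst.
exact: (@measurable_proj _ _ (fun _ : 'I_m => measurableTypeR R) i).
Qed.

(** Reflection in the hyperplane orthogonal to [u]; since [0^-1 = 0], it is the
    identity when [u] is zero, which is the case [x = y] of [reflection_swap]. *)
Definition reflection u x : euclid R m :=
  eadd x (escale (- (2 * dot x u / dot u u)) u).

Lemma measurable_reflection u : measurable_fun setT (reflection u).
Proof.
apply/measurable_dprodP => i; apply: measurable_funD.
  exact: (@measurable_proj _ _ (fun _ : 'I_m => measurableTypeR R) i).
apply: measurable_funM; last exact: measurable_cst.
rewrite (_ : (fun x => _) = (fun x => dot u x * (- (2 / dot u u)))).
  by apply: measurable_funM; [exact: measurable_dot|exact: measurable_cst].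
by apply/funext => x; rewrite dotC; ring.
Qed.

Lemma reflectionD u x y :
  reflection u (eadd x y) = eadd (reflection u x) (reflection u y).
Proof. by apply/funext => i; rewrite /reflection dotDl /eadd /escale; ring. Qed.

Lemma reflectionZ u t x : reflection u (escale t x) = escale t (reflection u x).
Proof. by apply/funext => i; rewrite /reflection dotZl /eadd /escale; ring. Qed.

Lemma dot_eq0 u : dot u u = 0 -> u = fun=> 0.
Proof.
move=> /eqP; rewrite /dot psumr_eq0; last by move=> i _; rewrite -expr2 sqr_ge0.
move=> /allP u0; apply/funext => i.
by have := u0 i (mem_index_enum i); rewrite /= mulf_eq0 orbb => /eqP.
Qed.

Lemma dot_reflection u x : dot (reflection u x) u = - dot x u.
Proof.
rewrite /reflection dotDl dotZl.
have [u0|u0] := eqVneq (dot u u) 0; last by field.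
have : dot x u = 0 by rewrite /dot (dot_eq0 u0) big1// => i _; rewrite mulr0.
by move=> ->; ring.
Qed.

Lemma reflectionK u : involutive (reflection u).
Proof.
move=> x; rewrite {1}/reflection dot_reflection; apply/funext => i.
by rewrite /reflection /eadd /escale; ring.
Qed.

Lemma enorm_reflection u x : enorm (reflection u x) = enorm x.
Proof.
rewrite !enormE; congr Num.sqrt.
rewrite {2}/reflection dotC dotDl dotZl (dotC u) dot_reflection.
by rewrite dotC {1}/reflection dotDl dotZl (dotC u); ring.
Qed.

(** The hyperplane bisecting [x] and [y] is orthogonal to [x - y], and it contains
    the origin when [x] and [y] have the same norm. *)
Lemma reflection_swap x y : dot x x = dot y y ->
  reflection (eadd x (escale (-1) y)) x = y.
Proof.
move=> xy; set u := eadd _ _.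
have uu : dot u u = 2 * dot x u.
  have uE z : dot z u = dot x z - dot y z by rewrite dotC dotDl dotZl mulN1r.
  by rewrite {1}/u dotDl dotZl !uE -xy (dotC y x); ring.
have [u0|u0] := eqVneq (dot u u) 0.
  have uE := dot_eq0 u0; apply/funext => i.
  have : x i = y i.
    apply/eqP; rewrite -subr_eq0 -mulN1r; apply/eqP.
    by rewrite -[LHS]/(u i) uE.
  by rewrite /reflection uE /eadd /escale mulr0 addr0.
rewrite /reflection -uu divff//; apply/funext => i.
by rewrite /u /eadd /escale; ring.
Qed.

End euclid_isometries.

(** * Isometry invariance of the Lebesgue measure *)

Section lebesgue_isometry.
Context (R : realType) (m : nat).
Implicit Types (x y u : euclid R m) (T : euclid R m -> euclid R m).
Local Open Scope ereal_scope.

Let lam := @lebesgue_measure_n R m.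

Definition unit_ball : set (euclid R m) := [set x | (enorm x <= 1)%R].

Lemma measurable_unit_ball : measurable unit_ball.
Proof.
rewrite (_ : unit_ball = @enorm R m @^-1` `]-oo, 1%R]%classic).
  by rewrite -[X in measurable X]setTI; exact: measurable_enorm.
by apply/seteqP; split => x; rewrite /unit_ball/= in_itv.
Qed.

Lemma abs_coord_le_enorm x i : (`|x i| <= enorm x)%R.
Proof.
rewrite -sqrtr_sqr ler_sqrt; last by rewrite sumr_ge0// => j _; exact: sqr_ge0.
by rewrite (bigD1 i)//= lerDl sumr_ge0// => j _; exact: sqr_ge0.
Qed.

Lemma enormN x : enorm x = enorm (escale (-1) x).
Proof. by congr Num.sqrt; apply: eq_bigr => i _; rewrite /escale mulN1r sqrrN. Qed.

Lemma lebesgue_box (a b : R) : (a < b)%R ->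
  lam [set x : euclid R m | forall i, `[a, b]%classic (x i)] =
  (((b - a) ^+ m)%R)%:E.
Proof.
move=> ab; rewrite /lam /lebesgue_measure_n.
rewrite (@dprod_measure_box R _ _ (fun _ : 'I_m => measurableTypeR R) _
  (fun=> `[a, b]%classic)); last by move=> i; exact: measurable_itv.
under eq_bigr do rewrite /= lebesgue_measure_itv/= lte_fin ab -EFinB.
by rewrite prodEFin prodr_const card_ord.
Qed.

Lemma measurable_cube (a b : R) :
  measurable [set x : euclid R m | forall i, `[a, b]%classic (x i)].
Proof.
apply: (@measurable_box _ _ (fun _ : 'I_m => measurableTypeR R)
  (fun=> `[a, b]%classic)) => i.
exact: measurable_itv.
Qed.

(** A cube of side [1 / (m + 1)] fits in the unit ball, as
   [m * (1 / (m + 1)) ^ 2 <= 1]; this choice also covers [m = 0]. *)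
Lemma unit_ball_gt0 : 0 < lam unit_ball.
Proof.
have c0 : (0 < m.+1%:R^-1 :> R)%R by rewrite invr_gt0.
suff: lam [set x : euclid R m |
    forall i, `[0%R, (m.+1%:R^-1)%R]%classic (x i)] <= lam unit_ball.
  by apply: lt_le_trans; rewrite lebesgue_box// lte_fin subr0 exprn_gt0.
apply: le_measure; rewrite ?inE; [exact: measurable_cube|exact: measurable_unit_ball|].
move=> x xc; rewrite /unit_ball/= /enorm -(sqrtr1 R) ler_sqrt//.
apply: (@le_trans _ _ (\sum_(i < m) m.+1%:R^-1)%R).
  apply: ler_sum => i _; have := xc i; rewrite /= in_itv/= => /andP[x0 x1].
  have c1 : (m.+1%:R^-1 <= 1 :> R)%R by rewrite invf_le1// ler1n.
  by rewrite expr2 -[leRHS]mulr1 ler_pM// (le_trans x1).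
rewrite sumr_const card_ord -[X in (X <= _)%R]mulr_natl ler_pdivrMr// mul1r ler_nat.
exact: leqnSn.
Qed.

Lemma unit_ball_lty : lam unit_ball < +oo.
Proof.
suff /le_lt_trans : lam unit_ball <= lam [set x : euclid R m |
    forall i, `[(-1)%R, 1%R]%classic (x i)].
  by apply; rewrite lebesgue_box ?ltry// ltrN10.
apply: le_measure; rewrite ?inE; [exact: measurable_unit_ball|exact: measurable_cube|].
move=> x x1 i; rewrite /= in_itv/= -ler_norml.
exact: le_trans (abs_coord_le_enorm x i) x1.
Qed.

Lemma preserves_lebesgue_n_translation x : preserves lam (fun y => eadd y x).
Proof.
apply: (@preserves_dprod R m _ (fun=> measurableTypeR R) (fun=> @lebesgue_measure R)
  (fun i (t : R) => (t + x i)%R)) => i.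
exact: preserves_lebesgue_translation.
Qed.

(** Translation invariance together with the mass of the unit ball characterises
    the Lebesgue measure, and an additive isometry affects neither of them. *)
Lemma preserves_lebesgue_n_isometry T :
  measurable_fun setT T ->
  (forall x y, T (eadd x y) = eadd (T x) (T y)) ->
  (forall x, enorm (T x) = enorm x) ->
  (forall x, exists y, T y = x) ->
  preserves lam T.
Proof.
move=> mT TD Tn Ts; split => // A mA.
have trans C x : measurable C -> lam [set y | C (eadd y x)] = lam C.
  by move=> mC; have [_ ->] := preserves_lebesgue_n_translation x.
have mproj i : measurable_fun setT (fun x : euclid R m => x i).
  exact: (@measurable_proj _ _ (fun _ : 'I_m => measurableTypeR R) i).
have mTi i : measurable_fun setT (fun x => T x i).
  exact: measurableT_comp (mproj i) mT.
have mTA : measurable (T @^-1` A) by rewrite -[X in measurable X]setTI; exact: mT.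
have mB := measurable_unit_ball.
(* [W'] is what [W] becomes after the translation of the first component by
   [T y], performed below for each fixed [y]. *)
pose W := [set p : euclid R m * euclid R m | unit_ball p.1 /\ A (eadd (T p.2) p.1)].
pose W' := [set p : euclid R m * euclid R m |
  A p.1 /\ unit_ball (eadd p.1 (escale (-1) (T p.2)))].
have mW : measurable W.
  rewrite (_ : W = (fst @^-1` unit_ball) `&`
      (fun p => eadd (T p.2) p.1) @^-1` A); last by [].
  apply: measurableI; rewrite -[X in measurable X]setTI.
    exact: measurable_fst.
  suff : measurable_fun setT
    (fun p : euclid R m * euclid R m => eadd (T p.2) p.1) by exact.
  apply/measurable_dprodP => i; apply: measurable_funD.
    exact: measurableT_comp (mTi i) measurable_snd.
  exact: measurableT_comp (mproj i) measurable_fst.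
have mW' : measurable W'.
  rewrite (_ : W' = (fst @^-1` A) `&`
      (fun p => eadd p.1 (escale (-1) (T p.2))) @^-1` unit_ball); last by [].
  apply: measurableI; rewrite -[X in measurable X]setTI.
    exact: measurable_fst.
  suff : measurable_fun setT
    (fun p : euclid R m * euclid R m => eadd p.1 (escale (-1) (T p.2))) by exact.
  apply/measurable_dprodP => i; apply: measurable_funD.
    exact: measurableT_comp (mproj i) measurable_fst.
  apply: measurable_funM; first exact: measurable_cst.
  exact: measurableT_comp (mTi i) measurable_snd.
have intE (c : \bar R) C (F : euclid R m -> set (euclid R m)) :
    measurable C -> (forall x, C x -> lam (F x) = c) ->
    (forall x, ~ C x -> F x = set0) -> \int[lam]_x lam (F x) = c * lam C.
  move=> mC Fc F0; rewrite -integral_cst// [RHS]integral_mkcond.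
  apply: eq_integral => x _; rewrite patchE; case: ifPn.
    by rewrite inE => /Fc.
  by rewrite notin_setE => /F0 ->; rewrite measure0.
(* For [x = T x0], the section of [W] is the preimage of [A] under [T], translated
   by [- x0]. *)
have EW : \int[lam]_x lam (xsection W x) = lam (T @^-1` A) * lam unit_ball.
  apply: intE => // x.
    move=> Bx; have [x0 Tx0] := Ts x; rewrite -(trans _ x0 mTA); congr (lam _).
    apply/seteqP; split => y; rewrite /xsection/= inE /W/= TD Tx0//.
    by move=> [].
  move=> Bx; apply/seteqP; split => y //; rewrite /xsection/= inE.
  by move=> [].
(* For [x = T x0], the norm of [x - T y] is that of [y - x0], so the section of
   [W'] is the unit ball centred at [x0]. *)
have EW' : \int[lam]_x lam (xsection W' x) = lam unit_ball * lam A.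
  apply: intE => // x.
    move=> Ax; have [x0 Tx0] := Ts x.
    rewrite -(trans _ (escale (-1) x0) mB); congr (lam _).
    have e y : enorm (eadd x (escale (-1) (T y))) = enorm (eadd y (escale (-1) x0)).
      rewrite -(Tn (eadd y _)) [RHS](enormN) -Tx0; congr enorm; apply/funext => i.
      have yE : eadd (eadd y (escale (-1) x0)) x0 = y.
        by apply/funext => j; rewrite /eadd /escale; ring.
      by rewrite -{1}yE TD /eadd /escale; ring.
    apply/seteqP; split => y; rewrite /xsection/= inE /W'/unit_ball/= e//.
    by move=> [].
  move=> Ax; apply/seteqP; split => y //; rewrite /xsection/= inE.
  by move=> [].
have : lam (T @^-1` A) * lam unit_ball = lam unit_ball * lam A.
  rewrite -EW -EW' !exchange_sections//; apply: eq_integral => y _.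
  have mWy : measurable (ysection W' y) by exact: measurable_ysection.
  rewrite -(trans _ (T y) mWy); congr (lam _).
  have xE x : eadd (eadd x (T y)) (escale (-1) (T y)) = x.
    by apply/funext => j; rewrite /eadd /escale; ring.
  have Cx x : eadd (T y) x = eadd x (T y).
    by apply/funext => j; rewrite /eadd addrC.
  by apply/seteqP; split => x; rewrite /ysection/= !inE /W /W'/= xE Cx => -[].
rewrite muleC; apply: inc_inj; apply: lee_pmul2l; last exact: unit_ball_gt0.
by rewrite ge0_fin_numE//; exact: unit_ball_lty.
Qed.

Lemma preserves_lebesgue_n_reflection u : preserves lam (reflection u).
Proof.
apply: preserves_lebesgue_n_isometry.
- exact: measurable_reflection.
- exact: reflectionD.
- exact: enorm_reflection.
- by move=> x; exists (reflection u x); rewrite reflectionK.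
Qed.

End lebesgue_isometry.

(** * Reflections of the unit sphere *)

Section spheres.
Context (R : realType) (n : nat).
Implicit Types (x y u : euclid R n.+1) (A : set (sphere R n)).

Definition sphere_point y (hy : y \in @unit_sphere R n) : sphere R n :=
  exist _ y hy.

(** The cone is the part of the punctured unit ball on which the radial projection
    [y |-> y / enorm y] takes its values in [A]. *)
Lemma measurable_cone A : measurable A -> measurable (cone A).
Proof.
move=> [B mB <-]; rewrite setTI.
rewrite (_ : cone _ = [set y | 0 < enorm y <= 1] `&`
    (fun y => escale (enorm y)^-1 y) @^-1` B).
  apply: measurableI; rewrite -[X in measurable X]setTI.
    rewrite (_ : [set y | _] = @enorm R n.+1 @^-1` `]0, 1]%classic).
      exact: measurable_enorm.
    by apply/seteqP; split => y /=; rewrite in_itv.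
  suff : measurable_fun setT (fun y : euclid R n.+1 => escale (enorm y)^-1 y) by exact.
  apply/measurable_dprodP => i; apply: measurable_funM.
    rewrite (_ : (fun y => _) = (fun t : R => t `^ (-1)) \o @enorm R n.+1).
      by apply: measurableT_comp; [exact: measurable_powR|exact: measurable_enorm].
    by apply/funext => y /=; rewrite powR_inv1 ?sqrtr_ge0.
  exact: (@measurable_proj _ _ (fun _ : 'I_n.+1 => measurableTypeR R) i).
have nZ t y : enorm (escale t y) = `|t| * enorm y.
  by rewrite !enormE dotZl dotC dotZl mulrA -expr2 sqrtrM ?sqr_ge0// sqrtr_sqr.
have eK t y : t != 0 -> escale t^-1 (escale t y) = y.
  by move=> t0; apply/funext => i; rewrite /escale mulKf.
apply/seteqP; split => [w [t] /=|y /= [/andP[y0 y1] By]].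
  rewrite in_itv/= => /andP[t0 t1] [z Bz <-].
  have z1 : enorm (val z) = 1 by have := valP z; rewrite inE.
  have nt : enorm (escale t (val z)) = t by rewrite nZ z1 mulr1 gtr0_norm.
  rewrite -/(escale t (val z)) nt eK ?gt_eqF//.
  by split => //; rewrite t0.
have y'1 : escale (enorm y)^-1 y \in @unit_sphere R n.
  by rewrite inE /unit_sphere/= nZ normfV gtr0_norm// mulVf// gt_eqF.
exists (enorm y); first by rewrite /= in_itv/= y0.
exists (sphere_point y'1); first exact: By.
by apply/funext => i; rewrite /= /escale mulVKf// gt_eqF.
Qed.

Lemma reflection_sphere u (x : sphere R n) :
  reflection u (val x) \in @unit_sphere R n.
Proof. by rewrite inE /unit_sphere/= enorm_reflection; have := valP x; rewrite inE. Qed.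

Definition sphere_reflection u (x : sphere R n) : sphere R n :=
  sphere_point (reflection_sphere u x).

Lemma val_sphere_reflection u (x : sphere R n) :
  val (sphere_reflection u x) = reflection u (val x).
Proof. by []. Qed.

Lemma sphere_reflectionK u : involutive (sphere_reflection u).
Proof. by move=> x; apply: val_inj; rewrite !val_sphere_reflection reflectionK. Qed.

Lemma measurable_sphere_val : measurable_fun setT (val : sphere R n -> euclid R n.+1).
Proof. by move=> _ B mB; exists B. Qed.

Lemma measurable_sphere_reflection u : measurable_fun setT (sphere_reflection u).
Proof.
move=> _ _ [B mB <-]; rewrite !setTI.
exists (reflection u @^-1` B).
  by rewrite -[X in measurable X]setTI; exact: measurable_reflection.
by rewrite setTI.
Qed.

(** By linearity of the reflection, the cone over the preimage of [A] is the
    preimage of the cone over [A]. *)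
Lemma preserves_sphere_reflection u :
  preserves (@surface_measure R n) (sphere_reflection u).
Proof.
split; first exact: measurable_sphere_reflection.
move=> A mA; rewrite /surface_measure.
have [_ lamP] := preserves_lebesgue_n_reflection u.
rewrite -(lamP (cone A)); last exact: measurable_cone.
congr (_ * _)%E; congr (lebesgue_measure_n _ _).
apply/seteqP; split => [_ [t] t01 [x Ax <-]|y [t] t01 [x Ax yE]].
  exists t => //; exists (sphere_reflection u x) => //.
  by rewrite val_sphere_reflection -[LHS]/(escale t _) -reflectionZ.
exists t => //; exists (sphere_reflection u x).
  by rewrite /= sphere_reflectionK.
rewrite val_sphere_reflection -[LHS]/(escale t _) -reflectionZ.
by rewrite -(reflectionK u y) -yE.
Qed.

Lemma sphere_reflection_transitive (x y : sphere R n) :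
  exists u, sphere_reflection u x = y.
Proof.
exists (eadd (val x) (escale (-1) (val y))); apply: val_inj.
rewrite val_sphere_reflection; apply: reflection_swap.
have dot1 (z : sphere R n) : dot (val z) (val z) = 1.
  have := valP z; rewrite inE /unit_sphere/= enormE => z1.
  rewrite -(@sqr_sqrtr _ (dot _ _)) ?z1 ?expr1n//.
  by apply: sumr_ge0 => i _; rewrite -expr2 sqr_ge0.
by rewrite !dot1.
Qed.

Lemma d_E_reflection u x y : d_E (reflection u x) (reflection u y) = d_E x y.
Proof.
have dE a b : d_E a b = enorm (eadd a (escale (-1) b)).
  by congr Num.sqrt; apply: eq_bigr => i _; rewrite /eadd /escale mulN1r.
by rewrite !dE -reflectionZ -reflectionD enorm_reflection.
Qed.

(** Needed because [f] is only assumed measurable on the cube [[0, 2] ^ r]. *)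
Lemma d_E_sphere_bounds (x y : sphere R n) : 0 <= d_E (val x) (val y) <= 2.
Proof.
have sum1 (z : sphere R n) : \sum_i (val z i) ^+ 2 = 1.
  have := valP z; rewrite inE /unit_sphere/= /enorm => z1.
  rewrite -(@sqr_sqrtr _ (\sum_i _)) ?z1 ?expr1n//.
  by apply: sumr_ge0 => i _; exact: sqr_ge0.
rewrite sqrtr_ge0/= -(@ler_pXn2r _ 2)// ?nnegrE ?sqrtr_ge0//.
rewrite sqr_sqrtr; last by apply: sumr_ge0 => i _; exact: sqr_ge0.
apply: (@le_trans _ _ (\sum_i (2 * (val x i) ^+ 2 + 2 * (val y i) ^+ 2))).
  have parallelogram (a b : R) : (a - b) ^+ 2 <= 2 * a ^+ 2 + 2 * b ^+ 2.
    rewrite -subr_ge0 (_ : _ - _ = (a + b) ^+ 2) ?sqr_ge0//; ring.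
  by apply: ler_sum => i _; exact: parallelogram.
by rewrite big_split/= -!mulr_sumr !sum1; lra.
Qed.

End spheres.

(** * Homogeneity of a product of spheres *)

Section prod_of_spheres.
Context (R : realType) (r : nat) (n : 'I_r -> nat) (f : euclid R r -> R).
Hypothesis mf : measurable_fun [set t : euclid R r | forall i, 0 <= t i <= 2] f.

Let X := prod_spheres R n.
Let mu := prod_surface_measure R n.

Lemma measurable_dist_of : measurable_fun setT
  (fun p : X * X => dist_of f p.1 p.2).
Proof.
pose coordinates (p : X * X) : euclid R r :=
  fun i => d_E (val (p.1 i)) (val (p.2 i)).
have mcube : measurable [set t : euclid R r | forall i, 0 <= t i <= 2].
  rewrite (_ : [set t | _] =
      [set t : euclid R r | forall i, `[0, 2]%classic (t i)]).
    exact: measurable_cube.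
  by apply/seteqP; split => t /= tc i; have := tc i; rewrite /= in_itv.
have mc : measurable_fun setT coordinates.
  apply/measurable_dprodP => i; rewrite /coordinates /d_E.
  have mval j (g : X * X -> X) : measurable_fun setT g ->
      measurable_fun setT (fun p => val (g p i) j).
    move=> mg.
    have mi : measurable_fun setT (fun x : X => x i).
      exact: (@measurable_proj _ _ (fun i => sphere R (n i)) i).
    have mj : measurable_fun setT (fun z : euclid R (n i).+1 => z j).
      exact: (@measurable_proj _ _ (fun=> measurableTypeR R) j).
    exact: measurableT_comp mj
      (measurableT_comp (@measurable_sphere_val R (n i)) (measurableT_comp mi mg)).
  have msqrt : measurable_fun [set: R] (@Num.sqrt R).
    by apply: continuous_measurable_fun; exact: sqrt_continuous.
  apply: (measurableT_comp msqrt); apply: measurable_sum => j.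
  apply: measurable_funX; apply: measurable_funB.
    exact: mval measurable_fst.
  exact: mval measurable_snd.
apply: (measurable_comp mcube) => [_ [p _ <-] i /=||//]; last exact: mf.
exact: d_E_sphere_bounds.
Qed.

Lemma measurable_pairs_at_distance (E : set R) : measurable E ->
  measurable (pairs_at_distance (dist_of (n := n) f) E).
Proof.
by move=> mE; rewrite -[X in measurable X]setTI; exact: measurable_dist_of.
Qed.

(** A product of reflections sending [x] to [x'] leaves every [d_E], hence the
    distance, unchanged and preserves the measure. *)
Lemma measure_at_distance_cst (E : set R) (x x' : X) : measurable E ->
  mu (xsection (pairs_at_distance (dist_of f) E) x) =
  mu (xsection (pairs_at_distance (dist_of f) E) x').
Proof.
move=> mE.
pose u i := projT1 (cid (sphere_reflection_transitive (x i) (x' i))).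
have uP i : sphere_reflection (u i) (x i) = x' i.
  exact: projT2 (cid (sphere_reflection_transitive (x i) (x' i))).
have [_ muP] : preserves mu
    (fun y : X => (fun i => sphere_reflection (u i) (y i)) : X).
  apply: (preserves_dprod (m := fun i => @surface_measure R (n i))
    (g := fun i => sphere_reflection (u i))) => i.
  exact: preserves_sphere_reflection.
rewrite -[RHS]muP; last first.
  by apply: measurable_xsection; exact: measurable_pairs_at_distance.
have distE y : dist_of f x' (fun i => sphere_reflection (u i) (y i)) =
    dist_of f x y.
  rewrite /dist_of; congr f; apply/funext => i.
  by rewrite -uP !val_sphere_reflection d_E_reflection.
by congr (mu _); apply/seteqP; split => y;
  rewrite /xsection /= !inE /pairs_at_distance/= distE.
Qed.

End prod_of_spheres.

(** * Distance distributions of complementary sets *)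

Theorem theorem3 (R : realType) (r : nat) (hr : (1 <= r)%N)
  (n : 'I_r -> nat) (hn : forall i, (1 <= n i)%N)
  (f : euclid R r -> R)
  (hmetric : is_metric (dist_of (n := n) f))
  (hf : measurable_fun [set t : euclid R r | forall i, 0 <= t i <= 2] f) :
  let mu := prod_surface_measure R n in
  let st := density_distance mu (dist_of f) in
  [/\ (forall A B : set (prod_spheres R n), measurable A -> measurable B ->
        (mu A - mu (~` A) = mu B - mu (~` B))%E ->
        forall E : set R, measurable E ->
          variation_measure (fun E' => st A A E' - st (~` A) (~` A) E')%E E =
          variation_measure (fun E' => st B B E' - st (~` B) (~` B) E')%E E),
      (forall A : set (prod_spheres R n), measurable A ->
        mu A = mu (~` A) ->
        forall E : set R, measurable E -> st A A E = st (~` A) (~` A) E)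
    & (forall S S' : set (prod_spheres R n), measurable S -> measurable S' ->
        (forall E : set R, measurable E -> st S S E = st S' S' E) ->
        (forall E : set R, measurable E ->
          st (~` S) (~` S) E = st (~` S') (~` S') E) /\
        (forall E : set R, measurable E ->
          st S (~` S) E = st S' (~` S') E))].
Proof.
move=> mu st.
have dC : forall x y : prod_spheres R n, dist_of f x y = dist_of f y x.
  by have [] := hmetric.
have mufin : fin_num_fun mu := prod_surface_measure_fin (n := n).
have mW (E : set R) : measurable E ->
    measurable (pairs_at_distance (dist_of (n := n) f) E).
  exact: measurable_pairs_at_distance.
pose c E := mu (xsection (pairs_at_distance (dist_of f) E) point).
have cE (E : set R) : measurable E -> forall x,
    mu (xsection (pairs_at_distance (dist_of f) E) x) = c E.
  by move=> mE x; exact: measure_at_distance_cst.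
have stB (A : set (prod_spheres R n)) (E : set R) : measurable A -> measurable E ->
    (st A A E - st (~` A) (~` A) E = c E * (mu A - mu (~` A)))%E.
  by move=> mA mE; apply: density_distanceB => //; [exact: mW|exact: cE].
have stfin (A B : set (prod_spheres R n)) (E : set R) :
    measurable A -> measurable B -> measurable E -> st A B E \is a fin_num.
  by move=> mA mB mE; apply: density_distance_fin => //; [exact: mW|exact: cE].
split.
- move=> A B mA mB AB E mE; apply: eq_variation_measure => F mF.
  by rewrite !stB// AB.
- move=> A mA AC E mE; have mAC := measurableC mA.
  have : (st A A E - st (~` A) (~` A) E = 0)%E.
    by rewrite stB// -AC subee ?mule0// mufin.
  by rewrite -{2}[st A A E](subeK _ (stfin _ _ _ mAC mAC mE)) => ->; rewrite add0e.
move=> S S' mS mS' SS'.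
have mSC := measurableC mS; have mSC' := measurableC mS'.
have stT (A : set (prod_spheres R n)) : measurable A -> st A A setT = (mu A * mu A)%E.
  move=> mA; rewrite /st density_distance_xsection//; last exact: mW.
  rewrite -integral_cst//; apply: eq_integral => x _.
  rewrite (_ : xsection _ x = setT) ?setTI//.
  by apply/seteqP; split => y // _; rewrite /xsection/= inE.
have muSS' : mu S = mu S'.
  have := SS' setT measurableT; rewrite !stT//.
  rewrite -(fineK (mufin _ mS)) -(fineK (mufin _ mS')) -!EFinM => -[/eqP].
  by rewrite -!expr2 eqrXn2 ?fine_ge0// => /eqP ->.
have muC : mu (~` S) = mu (~` S').
  have muSC (A : set (prod_spheres R n)) : measurable A ->
      (mu (~` A) = mu setT - mu A)%E.
    by move=> mA; rewrite -setTD measureD ?setTI// -ge0_fin_numE// mufin.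
  by rewrite !muSC// muSS'.
split=> E mE.
  have : (st S S E - st (~` S) (~` S) E = st S' S' E - st (~` S') (~` S') E)%E.
    by rewrite !stB// muSS' muC.
  by rewrite (SS' _ mE) => /(adde_fin_inj (stfin _ _ _ mS' mS' mE))/oppe_inj.
have := density_distance_complement mS mS (mW E mE) (cE E mE).
rewrite -/st muSS' -(density_distance_complement mS' mS' (mW E mE) (cE E mE)) -/st.
by rewrite (SS' _ mE) => /(adde_fin_inj (stfin _ _ _ mS' mS' mE)).
Qed.
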